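(* Consider $K\ge 2$ arms, $1\le m<K$, quantile level $\tau\in(0,1)$ and budget $N\ge\frac{4}{1-\tau}\overline{\log}(K)+K$, where $\overline{\log}(K)=\frac12+\sum_{i=2}^K\frac1i$. Each arm $i$ has an unknown reward distribution $F_i$ (arms independent, samples i.i.d. within an arm) satisfying the IHR assumption with hazard-rate lower bound $L_i>0$ and having a continuously differentiable density, and $b_i\ge0$ is a constant with $|\mathbb{E}[X^i_{(\lfloor n(1-\tau)\rfloor)}]-Q^\tau_i|\le b_i/n$ for all $n$ (where $X^i_{(j)}$ are order statistics of $n$ samples of arm $i$). Assume the set $\mathcal{S}_m^\ast$ of $m$ arms with the largest $\tau$-quantiles is unique. Then the Q-SAR algorithm returns a set $\mathcal{S}_m^N$ satisfying $$e_N:=\mathbb{P}\big(\mathcal{S}_m^N\ne\mathcal{S}_m^\ast\big)\le 2K^2\exp\Big(-\frac{N-K}{\overline{\log}(K)\,H^\tau}\Big),$$ where $H^\tau=\max_{i,j\in\{1,\dots,K\}}\frac{8j}{1-\tau}\Big(\frac{4\alpha}{L_i^2\Delta_{(j)}^2}+\frac{\beta_i}{L_i^2\Delta_{(j)}}\Big)$, $\alpha=\frac{4(1+\tau)}{1-\tau}$, $\beta_i=\frac43\big(2L_i+b_i(1-\tau)L_i^2\big)$.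
   Context: IHR assumption for a distribution: support $[0,\infty)$, density $f$, c.d.f. $F$, hazard rate $h=f/(1-F)$ non-decreasing, $L=\inf_x h(x)>0$. $Q^\tau_i:=\inf\{x:F_i(x)\ge\tau\}$. For $n$ samples of arm $i$ sorted decreasingly $X^i_{(1)}\ge\cdots\ge X^i_{(n)}$, the empirical quantile is $\hat Q^\tau_{i,n}:=X^i_{(\lfloor n(1-\tau)\rfloor)}$. Order arms as $o_1,\dots,o_K$ with $Q^\tau_{o_1}\ge\cdots\ge Q^\tau_{o_K}$; $\mathcal{S}_m^\ast=\{o_1,\dots,o_m\}$. Gaps: $\Delta_i=Q^\tau_i-Q^\tau_{o_{m+1}}$ if $i\in\mathcal{S}_m^\ast$, $\Delta_i=Q^\tau_{o_m}-Q^\tau_i$ otherwise; $\Delta_{(1)}\le\cdots\le\Delta_{(K)}$ are the gaps sorted non-decreasingly. Q-SAR algorithm: set $n_0=0$, $n_p=\big\lceil\frac{1}{\overline{\log}(K)}\frac{N-K}{K+1-p}\big\rceil$ for $p=1,\dots,K-1$; active set $\mathcal{A}_1=\{1,\dots,K\}$, accepted set $\mathcal{M}_1=\emptyset$, $l_1=m$. For each phase $p=1,\dots,K-1$: (1) sample each $i\in\mathcal{A}_p$ a further $n_p-n_{p-1}$ times (so each active arm has $n_p$ samples); (2) sort the active arms by empirical quantile $\hat Q^\tau_{i,n_p}$ in non-increasing order as $a_1,\dots,a_{K+1-p}$ (ties broken arbitrarily); (3) compute $\hat\Delta_{best}=\hat Q^\tau_{a_1,n_p}-\hat Q^\tau_{a_{l_p+1},n_p}$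 and $\hat\Delta_{worst}=\hat Q^\tau_{a_{l_p},n_p}-\hat Q^\tau_{a_{K+1-p},n_p}$; if $\hat\Delta_{best}>\hat\Delta_{worst}$, set $\mathcal{A}_{p+1}=\mathcal{A}_p\setminus\{a_1\}$, $\mathcal{M}_{p+1}=\mathcal{M}_p\cup\{a_1\}$, $l_{p+1}=l_p-1$; otherwise set $\mathcal{A}_{p+1}=\mathcal{A}_p\setminus\{a_{K+1-p}\}$, $\mathcal{M}_{p+1}=\mathcal{M}_p$, $l_{p+1}=l_p$. Return $\mathcal{S}_m^N=\mathcal{A}_K\cup\mathcal{M}_K$. *)

(* Defs.v *)
From HB Require Import structures.
From mathcomp Require Import all_boot all_order all_algebra.
From mathcomp Require Import all_classical all_reals all_analysis.
Set Implicit Arguments. Unset Strict Implicit. Unset Printing Implicit Defensive.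
Import Order.TTheory GRing.Theory Num.Theory.
Import numFieldNormedType.Exports.
Local Open Scope classical_set_scope.
Local Open Scope ring_scope.

Section QSAR.
Variable R : realType.

Definition logbar (K : nat) : R := 2^-1 + \sum_(2 <= i < K.+1) (i%:R)^-1.

(* X_(j) for a sample s sorted decreasingly X_(1) >= ... >= X_(n) (1-based).
   Convention: X_(0) := X_(1) (index j.-1). *)
Definition order_stat (s : seq R) (j : nat) : R :=
  nth 0 (sort (fun x y => y <= x) s) j.-1.

Definition emp_quantile (tau : R) (s : seq R) : R :=
  order_stat s (Num.truncn ((size s)%:R * (1 - tau))).

Definition dens_cdf (f : R -> R) (x : R) : R :=
  fine (\int[lebesgue_measure]_(t in [set t | (t <= x)%R]) (f t)%:E)%E.

Definition hazard (f : R -> R) (x : R) : R := f x / (1 - dens_cdf f x).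

Definition quantile (F : R -> R) (tau : R) : R := inf [set x | tau <= F x].

Definition IHR_density (f : R -> R) (L : R) : Prop :=
  [/\ measurable_fun setT f,
      (forall t, 0 <= f t),
      (forall t, t < 0 -> f t = 0),
      (forall x, dens_cdf f x < 1) &            (* h well defined *)
      [/\ (forall x y, 0 <= x -> x <= y -> hazard f x <= hazard f y),
           L = inf [set hazard f x | x in [set x | 0 <= x]] &
           0 < L]].

(* continuously differentiable density (on the interior (0,oo) of the support) *)
Definition C1_density (f : R -> R) : Prop :=
  (forall x, 0 < x -> derivable f x 1) /\
  (forall x, 0 < x -> {for x, continuous (derive1 f)}).

Definition mutually_independent d (T : measurableType d) (P : probability T R)
  (I : eqType) (X : I -> T -> R) : Prop :=
  forall (J : seq I) (B : I -> set R), uniq J -> (forall j, measurable (B j)) ->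
    P (\big[setI/setT]_(j <- J) (X j @^-1` B j)) =
    (\prod_(j <- J) P (X j @^-1` B j))%E.

Definition is_top_set (K : nat) (Q : 'I_K -> R) (m : nat) (S : {set 'I_K}) : Prop :=
  #|S| = m /\ (forall i j, i \in S -> j \notin S -> Q j <= Q i).

Definition sorted_quantiles (K : nat) (Q : 'I_K -> R) : seq R :=
  sort (fun x y => y <= x) [seq Q i | i <- enum 'I_K].

Definition Qo (K : nat) (Q : 'I_K -> R) (j : nat) : R := nth 0 (sorted_quantiles Q) j.-1.

Definition gap (K : nat) (Q : 'I_K -> R) (m : nat) (S : {set 'I_K}) (i : 'I_K) : R :=
  if i \in S then Q i - Qo Q m.+1 else Qo Q m - Q i.

Definition sorted_gap (K : nat) (Q : 'I_K -> R) (m : nat) (S : {set 'I_K}) (j : nat) : R :=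
  nth 0 (sort (fun x y => x <= y) [seq gap Q m S i | i <- enum 'I_K]) j.-1.

Definition alpha_c (tau : R) : R := 4 * (1 + tau) / (1 - tau).
Definition beta_c (tau L b : R) : R := 4 / 3 * (2 * L + b * (1 - tau) * L ^+ 2).

Definition H_tau (K : nat) (tau : R) (L b : 'I_K -> R) (Q : 'I_K -> R) (m : nat)
  (S : {set 'I_K}) : R :=
  \big[Num.max/0]_(i < K) \big[Num.max/0]_(j < K)
    (8 * j.+1%:R / (1 - tau) *
      (4 * alpha_c tau / (L i ^+ 2 * sorted_gap Q m S j.+1 ^+ 2)
       + beta_c tau (L i) (b i) / (L i ^+ 2 * sorted_gap Q m S j.+1))).

Definition n_phase (K N p : nat) : nat :=
  if p == 0%N then 0%N
  else `| Num.ceil ((logbar K)^-1 * ((N%:R - K%:R) / (K.+1 - p)%:R)) |%N.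

(* One phase p of Q-SAR. State = (active arms A_p, accepted arms M_p, l_p).
   x i k is the (k+1)-th sample of arm i; at phase p each active arm has
   its first n_p samples.  Sorting of active arms is non-increasing in the
   empirical quantile, ties broken by the (arbitrary) total relation tb p. *)
Definition qsar_step (K N : nat) (tau : R) (tb : nat -> rel 'I_K)
  (x : 'I_K -> nat -> R) (st : seq 'I_K * seq 'I_K * nat) (p : nat)
  : seq 'I_K * seq 'I_K * nat :=
  let: (A, M, l) := st in
  let n := n_phase K N p in
  let q i := emp_quantile tau [seq x i k | k <- iota 0 n] in
  let a := sort (fun i j => (q j < q i) || ((q i == q j) && tb p i j)) A in
  let qa := [seq q i | i <- a] in
  let r := size a in
  let dbest := nth 0 qa 0 - nth 0 qa l in
  let dworst := nth 0 qa l.-1 - nth 0 qa r.-1 in       (* Q(a_l) - Q(a_{K+1-p}) *)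
  if dbest > dworst then (behead a, take 1 a ++ M, l.-1)
  else (take r.-1 a, M, l).

Definition qsar (K N m : nat) (tau : R) (tb : nat -> rel 'I_K)
  (x : 'I_K -> nat -> R) : {set 'I_K} :=
  let: (A, M, _) := foldl (qsar_step N tau tb x) (enum 'I_K, [::], m) (iota 1 K.-1) in
  [set i | (i \in A) || (i \in M)].

End QSAR.

(* Main.v *)
(* With hazard rate at least L, the survival function loses at least a factor
   exp(-L g) over any distance g in the support, so P(X > Q + g) is at most
   (1 - tau) exp(-L g) and P(X > Q - g) is at least (1 - tau) exp(L g).
   The empirical quantile exceeds a level exactly when enough samples do, and
   Chernoff's bound on that binomial count makes each one-sided deviation by
   g = Delta / 4 in a given phase and for a given arm at most exp(-E), with
   E = (N - K) / (logbar K * H).  The rounding of the rank is harmless because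
   one may assume E >= 1, the bound being trivial otherwise.
   If no such deviation occurs, each phase makes a correct decision: with r
   active arms, one of them has a gap of at least Delta_(r), which rules out
   accepting a bad arm as well as rejecting a good one.  A union bound over
   phases, arms and signs gives the factor 2 K^2. *)
Require Import Defs.
From HB Require Import structures.
From mathcomp Require Import all_boot all_order all_algebra.
From mathcomp Require Import all_classical all_reals all_analysis.
From mathcomp Require Import measurable_realfun.
From mathcomp Require Import lra ring zify.
Import Order.TTheory GRing.Theory Num.Theory.
Import numFieldNormedType.Exports.
Local Open Scope classical_set_scope.
Local Open Scope ring_scope.

Set Implicit Arguments.
Unset Strict Implicit.
Unset Printing Implicit Defensive.

(** * Order statistics expressed through counts *)

Section SortedCounts.

(** A predicate inherited by earlier elements holds exactly on an initial segment of a sorted list,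
    and its count is the length of that segment. *)
Lemma nth_sorted_count (T : Type) (e : rel T) (a : pred T) x0 (s : seq T) k :
  transitive e -> (forall x y, e x y -> a y -> a x) -> sorted e s ->
  (k < size s)%N -> a (nth x0 s k) = (k < count a s)%N.
Proof.
move=> etr ea; elim: s k => [//|x s IHs] k /= xs ks.
have ss := path_sorted xs.
have [ax|nax] := boolP (a x); first by case: k ks => [|k] ks //=; exact: IHs.
have s0 : count a s = 0%N.
  have := order_path_min etr xs; elim: s {IHs xs ss ks} => //= y s IHs /andP[xy xs].
  by rewrite IHs// addn0; apply/eqP; rewrite eqb0; apply: contra nax; exact: ea.
case: k ks => [|k] ks /=; first by rewrite s0 (negbTE nax).
by rewrite IHs// s0 !ltn0.
Qed.

Lemma nth_sort_count (T : Type) (e : rel T) (a : pred T) x0 (s : seq T) k :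
  total e -> transitive e -> (forall x y, e x y -> a y -> a x) ->
  (k < size s)%N -> a (nth x0 (sort e s) k) = (k < count a s)%N.
Proof.
move=> eto etr ea ks.
rewrite (nth_sorted_count _ etr ea); last by rewrite size_sort.
  by rewrite count_sort.
exact: sort_sorted.
Qed.

Lemma sub_in_count (T : eqType) (a b : pred T) (s : seq T) :
  (forall x, x \in s -> a x -> b x) -> (count a s <= count b s)%N.
Proof.
elim: s => //= x s IHs ab; apply: leq_add.
  by have := ab x (mem_head x s); case: (a x) => // ->.
by apply: IHs => y ys; apply: ab; rewrite inE ys orbT.
Qed.

Variable R : realType.

Lemma ge_total : total (fun x y : R => y <= x).
Proof. by move=> x y; exact: le_total. Qed.

Lemma ge_trans : transitive (fun x y : R => y <= x).
Proof. by move=> x y z yx zx; exact: le_trans zx yx. Qed.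

Lemma truncn_index_lt (tau : R) n : 0 < tau < 1 -> (0 < n)%N ->
  ((Num.truncn (n%:R * (1 - tau))).-1 < n)%N.
Proof.
move=> /andP[t0 t1] n0.
have : (Num.truncn (n%:R * (1 - tau)) <= n)%N.
  rewrite -(ler_nat R); apply: (@le_trans _ _ (n%:R * (1 - tau))).
    by rewrite truncn_le mulr_ge0 ?ler0n//; lra.
  by rewrite ler_piMr ?ler0n//; lra.
by case: Num.truncn => //=.
Qed.

(** Reduces deviations of the order statistic to a count of samples. The predecessor makes the rank
    zero-based and sends rank 0 to the largest sample. *)
Lemma emp_quantile_gt (tau c : R) (s : seq R) : 0 < tau < 1 -> (0 < size s)%N ->
  (c < emp_quantile tau s) =
  ((Num.truncn ((size s)%:R * (1 - tau))).-1 < count (> c) s)%N.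
Proof.
move=> t01 s0; rewrite /emp_quantile /order_stat.
rewrite -[LHS]/((> c) (nth 0 _ _)) (nth_sort_count _ ge_total ge_trans)//.
- by move=> x y yx cy; exact: lt_le_trans cy yx.
- exact: truncn_index_lt.
Qed.

End SortedCounts.

(** * Elementary bounds for the Chernoff exponents *)

Section RealInequalities.
Variable R : realType.
Implicit Types s u t k : R.

(** Square of the tangent bound for [expR (- (u / 2))]; squaring requires [1 - u / 2] to be
    nonnegative. *)
Lemma expRN_ge_quadratic u : u <= 2 -> 1 - u + u ^+ 2 / 4 <= expR (- u).
Proof.
move=> u2; have -> : expR (- u) = expR (- (u / 2)) ^+ 2.
  by rewrite -expRM_natl; congr expR; field.
have -> : 1 - u + u ^+ 2 / 4 = (1 - u / 2) ^+ 2 by field.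
rewrite ler_sqr ?nnegrE ?expR_ge0//; last by lra.
exact: expR_ge1Dx.
Qed.

(* Here [s = n (1 - tau)], [u = L g] and [k] is the rank of the order statistic.
   Rounding the rank down may cost a factor [exp u]; it is absorbed because
   [1 <= t] forces [s * u] to be large. *)
Lemma upper_exponent_le s u t k : 0 < s -> 0 < u -> 1 <= t -> 1 <= k -> s <= k + 1 ->
  t * (8 + 16 / 3 * u) <= s * u ^+ 2 ->
  - (u * k) + s * (1 - expR (- u)) <= - t.
Proof.
move=> s0 u0 t1 k1 sk tE.
have e0 := expR_gt0 (- u).
(* Three ranges of [u]: up to 2 the quadratic bound applies; beyond, [1 - expR (- u) <= 1] suffices,
   combined first with [s - 1 <= k] and then with [s <= 2 * k]. *)
have [u2|u2] := leP u 2.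
  have := expRN_ge_quadratic u2.
  move=> /(ler_wpM2l (ltW s0)) eE.
  have uk : u * (s - 1) <= u * k by apply: ler_wpM2l; lra.
  suff : t + u <= s * u ^+ 2 / 4 by nra.
  have : u * 6 <= t * u * 6 by nra.
  nra.
have se : s * (1 - expR (- u)) <= s by nra.
(* The estimate from [s - 1 <= k] breaks down for large [u] because of a cubic term, the one from
   [s <= 2 * k] for [u] near 2; both hold at 16/5. *)
have [u3|u3] := leP u (16 / 5).
  have uk : u * (s - 1) <= u * k by apply: ler_wpM2l; lra.
  suff : t + u <= s * (u - 1) by nra.
  suff : (t + u) * u ^+ 2 <= s * (u - 1) * u ^+ 2 by rewrite ler_pM2r ?exprn_gt0.
  have h1 : t * (8 + 16 / 3 * u) * (u - 1) <= s * u ^+ 2 * (u - 1).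
    by apply: ler_wpM2r => //; lra.
  suff : (t + u) * u ^+ 2 <= t * (8 + 16 / 3 * u) * (u - 1) by lra.
  have h2 : u ^+ 2 + u ^+ 3 <= (8 + 16 / 3 * u) * (u - 1).
    have : 0 <= (u - 2) * (16 / 5 - u) by nra.
    nra.
  have h3 : u ^+ 3 <= t * u ^+ 3 by rewrite ler_peMl// exprn_ge0// ltW.
  have h4 : t * (u ^+ 2 + u ^+ 3) <= t * ((8 + 16 / 3 * u) * (u - 1)).
    by apply: ler_wpM2l => //; lra.
  nra.
have sk2 : s <= 2 * k by lra.
have h1 : u * s <= u * (2 * k) by apply: ler_wpM2l => //; lra.
suff : t <= s * (u / 2 - 1) by nra.
suff : t * (8 + 16 / 3 * u) <= s * (u / 2 - 1) * (8 + 16 / 3 * u).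
  by rewrite ler_pM2r//; lra.
apply: (le_trans tE); rewrite -mulrA; apply: ler_wpM2l; first exact: ltW.
nra.
Qed.

(** Rounding the rank down is favourable here, so [expR u >= (1 + u / 2) ^+ 2] serves for every
    positive [u]. *)
Lemma lower_exponent_le s u t k : 0 < s -> 0 < u -> k <= s ->
  t * (8 + 16 / 3 * u) <= s * u ^+ 2 -> 0 <= t ->
  u * k + s * (1 - expR u) <= - t.
Proof.
move=> s0 u0 ks tE t0.
have e2 : 1 + u + u ^+ 2 / 4 <= expR u.
  have -> : expR u = expR (u / 2) ^+ 2.
    by rewrite -expRM_natl; congr expR; field.
  have -> : 1 + u + u ^+ 2 / 4 = (1 + u / 2) ^+ 2 by field.
  rewrite ler_sqr ?nnegrE ?expR_ge0//; [exact: expR_ge1Dx|lra].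
have h1 : s * (1 + u + u ^+ 2 / 4) <= s * expR u by apply: ler_wpM2l => //; exact: ltW.
have h2 : u * k <= u * s by apply: ler_wpM2l => //; exact: ltW.
have h3 : t * 8 <= s * u ^+ 2 by nra.
have h4 : 0 <= s * u ^+ 2 by rewrite mulr_ge0 ?sqr_ge0 ?ltW.
nra.
Qed.

End RealInequalities.

(** * Deterministic analysis of one phase *)

Section SuccessiveAcceptsRejects.
Variables (R : realType) (I : finType) (S : {set I}).

(** No mistake so far: nothing outside [S] was accepted and nothing in [S] was rejected. Since [l]
    counts the good arms still active, [0 < l] forces the last remaining arm to be good. *)
Definition sar_inv (r : nat) (st : seq I * seq I * nat) : Prop :=
  let: (A, M, l) := st in
  [/\ uniq A, size A = r, l = count (mem S) A, (0 < l)%N &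
      {subset M <= S} /\ forall i, i \in S -> (i \in A) || (i \in M)].

(** The decision of [qsar_step], abstracted from the samples and from the sorting. *)
Definition sar_update (q : I -> R) (a M : seq I) (l : nat) : seq I * seq I * nat :=
  let qa := [seq q i | i <- a] in
  let dbest := nth 0 qa 0 - nth 0 qa l in
  let dworst := nth 0 qa l.-1 - nth 0 qa (size a).-1 in
  if dbest > dworst then (behead a, take 1 a ++ M, l.-1)
  else (take (size a).-1 a, M, l).

Lemma perm_sar_inv (r : nat) (A B M : seq I) (l : nat) :
  perm_eq B A -> sar_inv r (A, M, l) -> sar_inv r (B, M, l).
Proof.
move=> BA [uA sA lA l0 [MS SAM]]; split=> //.
- by rewrite (perm_uniq BA).
- by rewrite (perm_size BA).
- by rewrite lA; apply/esym/seq.permP.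
- by split=> // i /SAM; rewrite (perm_mem BA).
Qed.

(** [theta] and [eta] stand for the [m]-th and [m.+1]-th largest quantiles, [D] for a level reached
    by the gap of an active arm [i0]. With errors at most [D / 4], a wrong decision either
    contradicts the order of [a] at [i0], or has its own empirical gap below [D / 2] while [i0]
    makes the competing gap at least [D / 2]. *)
Lemma sar_update_inv (q Q : I -> R) (theta eta D : R) (a M : seq I) (l r : nat) :
  sorted (fun i j => q j <= q i) a -> (0 < r)%N -> sar_inv r.+1 (a, M, l) ->
  0 <= eta -> eta < theta -> 0 < D ->
  (forall i, i \in S -> theta <= Q i) -> (forall i, i \notin S -> Q i <= eta) ->
  (exists2 i, i \in a & if i \in S then D <= Q i - eta else D <= theta - Q i) ->
  (forall i, i \in a -> Q i - D / 4 <= q i <= Q i + D / 4) ->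
  sar_inv r (sar_update q a M l).
Proof.
move=> sqa r0 [ua sa la l0 [MS SaM]] eta0 eta_theta D0 QS QnS [i0 i0a gi0] qQ.
have etr : transitive (fun i j : I => q j <= q i).
  by move=> y x z yx zy; exact: le_trans zy yx.
have cnt_ge k c : (k < r.+1)%N -> (c <= q (nth i0 a k)) = (k < count (fun i => (c <= q i)%R) a)%N.
  move=> kr; apply: (nth_sorted_count _ etr) => //; last by rewrite sa.
  by move=> x y yx cy; exact: le_trans cy yx.
have cnt_gt k c : (k < r.+1)%N -> (c < q (nth i0 a k)) = (k < count (fun i => (c < q i)%R) a)%N.
  move=> kr; apply: (nth_sorted_count (a := fun i => (c < q i)%R) _ etr) => //; last by rewrite sa.
  by move=> x y yx cy; exact: lt_le_trans cy yx.
have gS i : i \in a -> i \in S -> theta - D / 4 <= q i.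
  by move=> ia iS; have := QS _ iS; have /andP[] := qQ _ ia; lra.
have gnS i : i \in a -> i \notin S -> q i <= eta + D / 4.
  by move=> ia iS; have := QnS _ iS; have /andP[] := qQ _ ia; lra.
have nthq k : (k < r.+1)%N -> nth 0 [seq q i | i <- a] k = q (nth i0 a k).
  by move=> kr; rewrite (nth_map i0) ?sa.
have lr : (l <= r.+1)%N by rewrite la -sa count_size.
have q_top i : i \in a -> q i <= q (nth i0 a 0).
  move=> ia; rewrite cnt_ge// -has_count; apply/hasP; exists i => //=.
have q_bot i : i \in a -> q (nth i0 a r) <= q i.
  move=> ia; rewrite leNgt; apply/negP => qi.
  have : (r < count (fun j => (q i < q j)%R) a)%N by rewrite -cnt_gt.
  have -> : r.+1 = size a by [].
  rewrite leqNgt => /negP; apply;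
  rewrite -[ltnRHS](count_predC (fun j => (q i < q j)%R)) -[ltnLHS]addn0.
  rewrite ltn_add2l -has_count; apply/hasP; exists i => //=.
  by rewrite -leNgt.
have ge_theta k : (k < l)%N -> theta - D / 4 <= q (nth i0 a k).
  move=> kl; rewrite cnt_ge; last exact: leq_trans kl lr.
  apply: (leq_trans kl); rewrite la.
  by apply: sub_in_count => i ia iS; exact: gS.
have le_eta k : (l <= k < r.+1)%N -> q (nth i0 a k) <= eta + D / 4.
  move=> /andP[lk kr]; rewrite leNgt cnt_gt// -leqNgt; apply: leq_trans lk.
  rewrite la; apply: sub_in_count => i ia.
  by apply: contraLR => /(gnS _ ia); rewrite -leNgt.
(* If [l] is the number of active arms, [nth 0 _ l] is the default value [0], and
   the best arm is accepted because its empirical quantile is positive. *)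
have [E0|lr1] := eqVneq l r.+1; last have {lr1}lr : (l < r.+1)%N by lia.
  have alS : all (mem S) a by rewrite all_count -la sa E0.
  have i0S : i0 \in S by apply: (allP alS).
  have qi0 : 0 < q i0.
    by move: gi0; rewrite i0S; have /andP[] := qQ _ i0a; lra.
  rewrite /sar_update sa E0 /= (nthq 0%N)// (nthq r)// [nth 0 _ r.+1]nth_default ?size_map ?sa//.
  rewrite subrr subr0 (lt_le_trans qi0 (q_top _ i0a)).
  case: a sa {sqa i0a qQ cnt_ge cnt_gt gS gnS nthq q_top q_bot ge_theta le_eta}
    ua la SaM alS => //= a0 a.
  move=> [sa] /andP[a0a ua] la SaM /andP[a0S alS]; split=> //.
  - by move: la; rewrite a0S E0 add1n => -[].
  - rewrite take0 /=; split=> i; first by rewrite inE => /orP[/eqP->|/MS].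
    by move/SaM; rewrite !inE orbA [(i \in a) || _]orbC.
rewrite /sar_update sa /= (nthq 0%N)// (nthq l)// (nthq r)// (nthq l.-1);
  last by apply: leq_ltn_trans lr; exact: leq_pred.
case: ltP => dcmp.
  (* With [l = 1] the worst arm is always rejected, so [l] never reaches [0]. *)
  have l1 : (1 < l)%N.
    rewrite ltnNge; apply/negP => l1; have l1' : l = 1%N by apply/eqP; rewrite eqn_leq l1.
    move: dcmp; rewrite l1' /= ltrD2l ltrN2 ltNge => /negP; apply.
    by apply: q_bot; apply: mem_nth; rewrite sa ltnS.
  have a0a : nth i0 a 0 \in a by apply: mem_nth; rewrite sa.
  have a0S : nth i0 a 0 \in S.
    apply/negPn/negP => a0S.
    (* With a bad arm on top, [i0] cannot be good, as it would lie above that arm; so [i0] is bad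
       and [dworst >= D / 2 > dbest]. *)
    have qa0 := gnS _ a0a a0S; have /andP[qi1 qi2] := qQ _ i0a.
    have qi0 := q_top _ i0a; have qi0' := q_bot _ i0a.
    have [i0S|i0S] := boolP (i0 \in S); move: gi0; rewrite ?i0S ?(negbTE i0S) => gi0.
      suff : (0 : R) < 0 by rewrite ltxx.
    by move: gi0 qi1 qa0 qi0 D0; clear; lra.
    have h1 : theta - D / 4 <= q (nth i0 a l.-1) by apply: ge_theta; rewrite ltn_predL.
    (* The [l] good arms and the bad arm on top all reach this level, so position [l] does too. *)
    have h2 : theta - D / 4 <= q (nth i0 a l).
      have h3 : theta - D / 4 <= q (nth i0 a 0) by apply: ge_theta.
      rewrite cnt_ge//.
      case: a a0S h3 sa la gS {sqa i0a qQ cnt_ge cnt_gt gnS nthq q_top q_bot ge_theta le_eta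
        dcmp h1 ua SaM qa0 a0a qi0 qi0'} => //= a0 a a0S h3 sa la gS.
      rewrite h3 add1n ltnS la (negbTE a0S) add0n.
      apply: sub_in_count => i ia iS; apply: gS => //; by rewrite inE ia orbT.
    suff : (0 : R) < 0 by rewrite ltxx.
    by move: gi0 h1 h2 qi2 qi0' qa0 dcmp eta_theta; clear; lra.
  case: a sa {sqa i0a qQ cnt_ge cnt_gt gS gnS nthq q_top q_bot ge_theta le_eta
    dcmp a0a} ua la SaM a0S => //= a0 a.
  move=> [sa] /andP[a0a ua] la SaM a0S; split=> //.
  - by rewrite la a0S.
  - by rewrite -subn1 subn_gt0.
  - rewrite take0 /=; split=> i; first by rewrite inE => /orP[/eqP->|/MS].
    by move/SaM; rewrite !inE orbA [(i \in a) || _]orbC.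
have zS : nth i0 a r \notin S.
  apply/negP => zS.
  have za : nth i0 a r \in a by apply: mem_nth; rewrite sa.
  (* The mirror case: a good arm at the bottom forces [i0] to be good, and then
     [dbest >= D / 2 > dworst]. *)
  have qz := gS _ za zS; have /andP[qi1 qi2] := qQ _ i0a.
  have qi0 := q_top _ i0a; have qi0' := q_bot _ i0a.
  have [i0S|i0S] := boolP (i0 \in S); move: gi0; rewrite ?i0S ?(negbTE i0S) => gi0; last first.
    suff : (0 : R) < 0 by rewrite ltxx.
    by move: gi0 qi2 qz qi0' D0; clear; lra.
  have h1 : q (nth i0 a l) <= eta + D / 4 by apply: le_eta; rewrite leqnn.
  have h3 : q (nth i0 a r) <= eta + D / 4 by apply: le_eta; rewrite ltnSn andbT -ltnS.
  (* Only good arms exceed this level, and the good arm at the bottom does not, so at most [l.-1]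
     arms do. *)
  have h2 : q (nth i0 a l.-1) <= eta + D / 4.
    rewrite leNgt cnt_gt; last by apply: leq_ltn_trans lr; exact: leq_pred.
    rewrite -leqNgt.
    move: sa la zS h3 gnS;
    case/lastP: a {sqa i0a qQ cnt_ge cnt_gt gS nthq q_top q_bot ge_theta le_eta
      dcmp h1 ua SaM qz za qi0 qi0'} => // a z.
    rewrite size_rcons => -[sa]; rewrite nth_rcons sa ltnn eqxx => la zS h3 gnS.
    rewrite la -cats1 !count_cat /= zS !addn0 addn1 /= ltNge h3 /= addn0.
    apply: sub_in_count => i ia; apply: contraLR => iS; rewrite -leNgt; apply: gnS => //.
    by rewrite mem_rcons inE ia orbT.
  suff : (0 : R) < 0 by rewrite ltxx.
    by move: gi0 h1 h2 h3 qi1 qi0 qz dcmp eta_theta; clear; lra.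
move: sa ua la zS SaM;
case/lastP: a {i0a sqa qQ cnt_ge cnt_gt gnS gS nthq q_top q_bot ge_theta le_eta dcmp} => // a z.
rewrite size_rcons => -[sa] ua la zS SaM.
rewrite -{1}sa -cats1 take_size_cat//.
move: zS; rewrite nth_rcons sa ltnn eqxx => zS.
split=> //.
- by move: ua; rewrite rcons_uniq => /andP[].
- by rewrite la -cats1 count_cat /= (negbTE zS) !addn0.
- split=> // i iS; have := SaM _ iS; rewrite mem_rcons inE.
  by rewrite (_ : i == z = false)//; apply/negbTE; apply: contra zS => /eqP <-.
Qed.

End SuccessiveAcceptsRejects.

(** * Gaps and the uniqueness of the top set *)

Section Gaps.
Variables (R : realType) (K m : nat) (Q : 'I_K -> R) (S : {set 'I_K}).
Hypotheses (m_gt0 : (0 < m)%N) (m_lt : (m < K)%N).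
Hypothesis S_top : is_top_set Q m S.
Hypothesis S_unique : forall S', is_top_set Q m S' -> S' = S.

(** Exchange argument: if [Q i = Q j], replacing [i] by [j] in [S] gives a second top set. *)
Lemma top_set_gt i j : i \in S -> j \notin S -> Q j < Q i.
Proof.
have [Sm Sle] := S_top; move=> iS jS; rewrite lt_neqAle Sle// andbT.
apply/eqP => Qji.
have ij : j != i by apply: contraNneq jS => ->.
suff /S_unique E : is_top_set Q m (j |: S :\ i) by move: jS; rewrite -E !inE eqxx.
split.
  rewrite cardsU1 !inE (negbTE ij) (negbTE jS) /= add1n -Sm.
  by rewrite [in RHS](cardsD1 i) iS.
move=> a c; rewrite !inE negb_or negb_and negbK => aS /andP[cj cS].
apply: (@le_trans _ _ (Q i)).
  by case/orP: cS => [/eqP->//|cS]; exact: Sle.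
case/orP: aS => [/eqP->|/andP[ai aS]]; first by rewrite Qji.
by rewrite -Qji; exact: Sle.
Qed.

Lemma count_enum (a : pred R) : count a [seq Q i | i <- enum 'I_K] = #|[set i | a (Q i)]%SET|.
Proof.
rewrite count_map -size_filter cardE {2}/enum_mem -enumT.
by congr size; apply: eq_filter => i; rewrite /= inE.
Qed.

Lemma nth_sorted_quantiles (a : pred R) k : (k < K)%N -> (forall x y, y <= x -> a y -> a x) ->
  a (nth 0 (sorted_quantiles Q) k) = (k < #|[set i | a (Q i)]%SET|)%N.
Proof.
move=> kK ea; rewrite /sorted_quantiles (nth_sort_count _ (@ge_total R) (@ge_trans R) ea).
  by rewrite count_enum.
by rewrite size_map size_enum_ord.
Qed.

Let gt_up (c x y : R) : y <= x -> c < y -> c < x.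
Proof. by move=> yx cy; exact: lt_le_trans cy yx. Qed.

Let ge_up (c x y : R) : y <= x -> c <= y -> c <= x.
Proof. by move=> yx cy; exact: le_trans cy yx. Qed.

Lemma Qo_le_top i : i \in S -> Qo Q m <= Q i.
Proof.
have [Sm Sle] := S_top; move=> iS; rewrite leNgt; apply/negP.
rewrite (nth_sorted_quantiles _ (@gt_up _)); last by apply: leq_ltn_trans m_lt; exact: leq_pred.
rewrite prednK//; apply/negP; rewrite -ltnNge -[ltnRHS]Sm.
apply: proper_card; apply/fintype.properP; split.
  apply/fintype.subsetP => j; rewrite inE => ij; apply/negPn/negP => /(Sle _ _ iS).
  by rewrite leNgt ij.
by exists i; rewrite // inE ltxx.
Qed.

Lemma le_QoS_nontop i : i \notin S -> Q i <= Qo Q m.+1.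
Proof.
have [Sm Sle] := S_top; move=> iS.
rewrite (nth_sorted_quantiles m_lt (@ge_up (Q i))) -Sm.
apply: proper_card; apply/fintype.properP; split.
  by apply/fintype.subsetP => j; rewrite inE => jS; exact: Sle.
by exists i; rewrite // inE lexx.
Qed.

(** If some top arm [i] had [Q i <= Qo Q m.+1], then more than [m] arms would reach [Q i], while
    [top_set_gt] confines these to [S]. *)
Lemma QoS_lt_Qo : Qo Q m.+1 < Qo Q m.
Proof.
have [Sm Sle] := S_top.
rewrite (nth_sorted_quantiles _ (@gt_up (Qo Q m.+1))); last first.
  by apply: leq_ltn_trans m_lt; exact: leq_pred.
rewrite prednK// -[leqLHS]Sm; apply: subset_leq_card; apply/fintype.subsetP => i iS; rewrite inE.
rewrite ltNge; apply/negP; rewrite (nth_sorted_quantiles m_lt (@ge_up (Q i))).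
rewrite leqNgt => /negP; apply; rewrite ltnS -[leqRHS]Sm; apply: subset_leq_card.
apply/fintype.subsetP => j; rewrite inE => ij; apply/negPn/negP => /(top_set_gt iS).
by rewrite ltNge ij.
Qed.

(** Supplies [0 <= eta] in [sar_update_inv], where the default 0 of [nth] is compared with empirical
    quantiles. *)
Lemma QoS_ge0 : (forall i, 0 <= Q i) -> 0 <= Qo Q m.+1.
Proof.
move=> Q0; rewrite (nth_sorted_quantiles m_lt (@ge_up 0)).
rewrite (_ : [set i | _]%SET = [set: 'I_K]%SET) ?cardsT ?card_ord//.
by apply/setP => i; rewrite !inE Q0.
Qed.

Lemma gap_gt0 i : 0 < gap Q m S i.
Proof.
rewrite /gap; case: ifPn => iS; rewrite subr_gt0.
  exact: lt_le_trans QoS_lt_Qo (Qo_le_top iS).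
exact: le_lt_trans (le_QoS_nontop iS) QoS_lt_Qo.
Qed.

Lemma sorted_gap_gt0 (j : 'I_K) : 0 < sorted_gap Q m S j.+1.
Proof.
rewrite /sorted_gap /=; set s := sort _ _.
have : nth 0 s j \in s by apply: mem_nth; rewrite size_sort size_map size_enum_ord.
by rewrite mem_sort => /mapP[i _ ->]; exact: gap_gt0.
Qed.

(** Pigeonhole: at most [j] arms have a gap below the [j.+1]-th smallest one. *)
Lemma sorted_gap_le (j : 'I_K) (A : seq 'I_K) : uniq A -> size A = j.+1 ->
  exists2 i, i \in A & sorted_gap Q m S j.+1 <= gap Q m S i.
Proof.
move=> uA sA; apply/hasP; rewrite -[has _ _]negbK -all_predC; apply/negP => allA.
have : ~~ (sorted_gap Q m S j.+1 < sorted_gap Q m S j.+1) by rewrite ltxx.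
rewrite /sorted_gap /=; set c := (X in _ < X); move/negP; apply.
pose a x := x < c.
rewrite -/(a (nth _ _ _)) (nth_sort_count (a := a) _ (@le_total _ R) (@le_trans _ R)).
- rewrite count_map -size_filter -[leqLHS]sA; apply: uniq_leq_size => // i iA.
  rewrite mem_filter mem_enum inE andbT /= /a ltNge.
  exact: (allP allA).
- by move=> x y xy; exact: le_lt_trans.
- by rewrite size_map size_enum_ord.
Qed.

End Gaps.

(** * Measurability of maps into discrete spaces *)

Section DiscreteMeasurability.
Context d (T : measurableType d).

(* Measurability of [g] when [C] carries the discrete sigma-algebra. *)
Definition dmeas (C : Type) (g : T -> C) : Prop := forall B : set C, measurable (g @^-1` B).

Lemma dmeas_cst (C : Type) (c : C) : dmeas (fun=> c).
Proof.
move=> B; have [Bc|Bc] := pselect (B c).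
  by rewrite (_ : _ @^-1` _ = setT)//; apply/seteqP; split.
by rewrite (_ : _ @^-1` _ = set0)//; apply/seteqP; split.
Qed.

Lemma dmeas_comp (C C' : Type) (h : C -> C') (g : T -> C) : dmeas g -> dmeas (h \o g).
Proof. by move=> mg B; rewrite comp_preimage; exact: mg. Qed.

(** The preimage splits along the countably many values of [g], so a computation can be checked one
    intermediate result at a time. *)
Lemma dmeas_bind (C : countType) (C' : Type) (h : C -> T -> C') (g : T -> C) :
  dmeas g -> (forall c, dmeas (h c)) -> dmeas (fun w => h (g w) w).
Proof.
move=> mg mh B.
rewrite (_ : _ @^-1` _ = \bigcup_c (g @^-1` [set c] `&` h c @^-1` B)).
  apply: countable_bigcupT_measurable; first exact: countableP.
  by move=> c; apply: measurableI; [exact: mg|exact: mh].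
apply/seteqP; split=> [w Bw|w [c _ [/= <-]]//].
by exists (g w).
Qed.

Lemma dmeas_bool (g : T -> bool) : measurable_fun setT g -> dmeas g.
Proof. by move=> mg B; rewrite -[X in measurable X]setTI; exact: mg. Qed.

Lemma dmeas_map (I : Type) (C : countType) (g : I -> T -> C) (s : seq I) :
  (forall i, dmeas (g i)) -> dmeas (fun w => [seq g i w | i <- s]).
Proof.
move=> mg; elim: s => [|i s IHs] /=; first exact: dmeas_cst.
apply: (dmeas_bind (h := fun c w => c :: [seq g j w | j <- s]) (mg i)) => c.
exact: (dmeas_comp (cons c) IHs).
Qed.

End DiscreteMeasurability.

(** * Measurability of the output of Q-SAR *)

Section QsarMeasurability.
Context d (T : measurableType d) (R : realType).

(** Rays generate the Borel sets, and exceeding [c] depends only on the finite list of comparisons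
    of the samples with [c]. *)
Lemma measurable_emp_quantile (tau : R) (x : nat -> T -> R) n : 0 < tau < 1 -> (0 < n)%N ->
  (forall k, measurable_fun setT (x k)) ->
  measurable_fun setT (fun w => emp_quantile tau [seq x k w | k <- iota 0 n]).
Proof.
move=> t01 n0 mx.
apply: (measurability _ (RGenOInfty.measurableE R)) => _ [_ [c ->] <-].
rewrite setTI.
pose g w := [seq c < x k w | k <- iota 0 n].
have mg : dmeas g.
  by apply: dmeas_map => k; apply: dmeas_bool; apply: measurable_fun_ltr.
have := mg [set s | ((Num.truncn (n%:R * (1 - tau))).-1 < count id s)%N].
congr measurable; apply/seteqP; split=> w /=;
  by rewrite in_itv /= andbT emp_quantile_gt ?size_map ?size_iota// /g !count_map.
Qed.

Variables (K m N : nat) (tau : R) (tb : nat -> rel 'I_K) (X : 'I_K -> nat -> T -> R).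
Hypotheses (tau01 : 0 < tau < 1) (mX : forall i k, measurable_fun setT (X i k)).
Hypothesis n_gt0 : forall p, (0 < p < K)%N -> (0 < n_phase R K N p)%N.

(** Empirical quantiles are not discrete, but the finite table [tbl] of their comparisons is, and it
    determines the sorted list. For a fixed list the decision is one further comparison. *)
Lemma dmeas_qsar_step st p : (0 < p < K)%N ->
  dmeas (fun w => qsar_step N tau tb (fun i k => X i k w) st p).
Proof.
case: st => [[A M] l] p0; rewrite /qsar_step.
set q := fun w i => emp_quantile tau [seq X i k w | k <- iota 0 (n_phase R K N p)].
have mq i : measurable_fun setT (q^~ i).
  by apply: measurable_emp_quantile => //; exact: n_gt0.
pose e w (ij : 'I_K * 'I_K) := (q w ij.2 < q w ij.1) || ((q w ij.1 == q w ij.2) && tb p ij.1 ij.2).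
pose tbl w := [seq e w ij | ij <- enum {: 'I_K * 'I_K}].
pose e' (t : seq bool) i j := nth false t (index (i, j) (enum {: 'I_K * 'I_K})).
have e'E w i j : e' (tbl w) i j = (q w j < q w i) || ((q w i == q w j) && tb p i j).
  rewrite /e' /tbl (nth_map (i, j)) ?nth_index ?mem_enum//.
  by rewrite index_mem mem_enum.
have mtbl : dmeas tbl.
  apply: dmeas_map => ij; apply: dmeas_bool; apply: measurable_or.
    exact: measurable_fun_ltr.
  apply: measurable_and; last exact: measurable_cst.
  exact: measurable_fun_eqr.
have sortE w : sort (fun i j => (q w j < q w i) || ((q w i == q w j) && tb p i j)) A =
               sort (e' (tbl w)) A.
  by congr (sort _ A); apply/funext => i; apply/funext => j; rewrite e'E.
have mnth (a : seq 'I_K) k : measurable_fun setT (fun w => nth 0 [seq q w i | i <- a] k).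
  elim: a k => [|i a IHa] [|k] /=;
    [exact: measurable_cst|exact: measurable_cst|exact: mq|exact: IHa].
pose upd a w := let qa := [seq q w i | i <- a] in
   if nth 0 qa l.-1 - nth 0 qa (size a).-1 < nth 0 qa 0 - nth 0 qa l
   then (behead a, take 1 a ++ M, l.-1) else (take (size a).-1 a, M, l).
have mupd a : dmeas (upd a).
  pose c w := nth 0 [seq q w i | i <- a] l.-1 - nth 0 [seq q w i | i <- a] (size a).-1
      < nth 0 [seq q w i | i <- a] 0 - nth 0 [seq q w i | i <- a] l.
  apply: (dmeas_comp (fun b : bool => if b then (behead a, take 1 a ++ M, l.-1)
     else (take (size a).-1 a, M, l)) (g := c)).
  by apply: dmeas_bool; apply: measurable_fun_ltr; apply: measurable_funB.
have := dmeas_bind (h := fun t w => upd (sort (e' t) A) w) mtbl (fun t => mupd _).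
by congr dmeas; apply/funext => w; rewrite /= -sortE.
Qed.

Lemma measurable_qsar (S : {set 'I_K}) :
  measurable [set w | qsar N m tau tb (fun i k => X i k w) != S].
Proof.
have mfold s st : (forall p, p \in s -> (0 < p < K)%N) ->
    dmeas (fun w => foldl (qsar_step N tau tb (fun i k => X i k w)) st s).
  elim: s st => [|p s IHs] st ps /=; first exact: dmeas_cst.
  have p0 : (0 < p < K)%N by apply: ps; exact: mem_head.
  apply: (dmeas_bind (h := fun c w => foldl (qsar_step N tau tb (fun i k => X i k w)) c s)
    (dmeas_qsar_step st p0)) => c.
  by apply: IHs => r rs; apply: ps; rewrite inE rs orbT.
have mq : dmeas (fun w => foldl (qsar_step N tau tb (fun i k => X i k w))
    (enum 'I_K, [::], m) (iota 1 K.-1)).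
  by apply: mfold => p; rewrite mem_iota; clear; lia.
have := mq [set st : seq 'I_K * seq 'I_K * nat |
  [set i : 'I_K | (i \in st.1.1) || (i \in st.1.2)]%SET != S].
by congr measurable; apply/funext => w; rewrite /= /qsar; case: foldl => [[A M] l].
Qed.

End QsarMeasurability.

(** * Passing to the limit in an inequality *)

Section Limits.
Variable R : realType.

Lemma ler_of_small (A B k dlt : R) : 0 < dlt -> 0 <= A ->
  (forall e, 0 < e < dlt -> A * (1 - k * e) <= B) -> A <= B.
Proof.
move=> d0 A0 h; rewrite leNgt; apply/negP => BA.
have k0 := normr_ge0 k.
(* Small enough that [A * (k * e) <= (A - B) / 2]; the added ones keep the denominator positive. *)
pose e := Num.min (dlt / 2) ((A - B) / (2 * (A + 1) * (`|k| + 1))).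
have c0 : 0 < 2 * (A + 1) * (`|k| + 1) by rewrite !mulr_gt0//; lra.
have e0 : 0 < e by rewrite lt_min divr_gt0//= divr_gt0// subr_gt0.
have ed : e < dlt by rewrite gt_min; apply/orP; left; lra.
have he : e * (2 * (A + 1) * (`|k| + 1)) <= A - B.
  by rewrite -ler_pdivlMr// ge_min lexx orbT.
have := h e; rewrite e0 ed => /(_ isT).
have ke : k * e <= (`|k| + 1) * e.
  by rewrite ler_wpM2r ?(ltW e0)//; have := ler_norm k; lra.
have : A * (k * e) <= (A + 1) * ((`|k| + 1) * e).
  apply: (le_trans (ler_wpM2l A0 ke)); rewrite ler_wpM2r//; last by lra.
  by rewrite mulr_ge0 ?(ltW e0)//; lra.
suff : 0 < (A - B) / 2 by nra.
by rewrite divr_gt0// subr_gt0.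
Qed.

End Limits.

(** * Exponential decay of the survival function *)

Section Survival.
Variables (R : realType) (f : R -> R) (L : R).
Hypothesis f_IHR : IHR_density f L.
Hypothesis int_fin : forall x,
  (\int[lebesgue_measure]_(t in [set t | (t <= x)%R]) (f t)%:E)%E \is a fin_num.

Let F := dens_cdf f.

Let F_E x : (F x)%:E = (\int[lebesgue_measure]_(t in [set t | (t <= x)%R]) (f t)%:E)%E.
Proof. by rewrite fineK. Qed.

Let mf : measurable_fun setT f. Proof. by case: f_IHR. Qed.
Let f_ge0 x : 0 <= f x. Proof. by case: f_IHR. Qed.
Let F_lt1 x : F x < 1. Proof. by case: f_IHR. Qed.
Let L_gt0 : 0 < L. Proof. by case: f_IHR => ? ? ? ? []. Qed.

Let mle x : measurable [set t : R | t <= x].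
Proof. by rewrite -set_itvNyc; exact: measurable_itv. Qed.

Lemma dens_cdf_mono : {homo F : x y / x <= y}.
Proof.
move=> x y xy; rewrite -lee_fin !F_E; apply: ge0_subset_integral; [exact: mle|exact: mle|..].
- by apply/measurable_EFinP; exact: measurable_funTS.
- by move=> t _; rewrite lee_fin.
- by move=> t /= tx; exact: le_trans tx xy.
Qed.

Lemma hazard_ge x : 0 <= x -> L * (1 - F x) <= f x.
Proof.
move=> x0; have [_ _ _ _ [_ -> _]] := f_IHR.
rewrite -ler_pdivlMr ?subr_gt0//; apply: ge_inf; last by exists x.
exists 0 => _ [y _ <-]; rewrite /hazard divr_ge0//.
by rewrite subr_ge0 ltW//; exact: F_lt1.
Qed.

(** On []x, y]] the density is at least [L * (1 - F t)], hence at least the constant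
    [L * (1 - F y)], which is then integrated. *)
Lemma dens_cdf_increment x y : 0 <= x -> x <= y -> L * (y - x) * (1 - F y) <= F y - F x.
Proof.
move=> x0 xy; rewrite lerBrDl -lee_fin EFinD !F_E.
have -> : [set t : R | t <= y] = [set t | t <= x] `|` `]x, y]%classic.
  apply/seteqP; split => t /=; rewrite in_itv /=; first by case: leP => tx ty; [left|right].
  by case=> [tx|/andP[]//]; exact: le_trans tx xy.
rewrite ge0_integral_setU; last 5 first.
- exact: mle.
- exact: measurable_itv.
- by apply/measurable_EFinP; exact: measurable_funTS.
- by move=> t _; rewrite lee_fin.
- apply/disj_setPLR => t /= tx; rewrite in_itv /= => /andP[]; by rewrite ltNge tx.
rewrite leeD2l//.
have -> : (L * (y - x) * (1 - F y))%:E =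
    (\int[lebesgue_measure]_(t in `]x, y]%classic) (L * (1 - F y))%:E)%E.
  rewrite integral_cst; last exact: measurable_itv.
  have -> : (L * (y - x) * (1 - F y))%:E = ((L * (1 - F y))%:E * (y - x)%:E)%E.
    by rewrite -EFinM; congr EFin; ring.
  congr (_ * _)%E; apply/esym/(eq_trans (lebesgue_measure_itv `]x, y])) => /=.
  rewrite lte_fin; case: ifPn => [_|]; [by rewrite EFinB|rewrite -leNgt => yx].
  have -> : y = x by apply/eqP; rewrite eq_le; apply/andP; split.
  by rewrite subrr.
apply: ge0_le_integral => //.
- by move=> t _; rewrite lee_fin mulr_ge0 ?(ltW L_gt0)// subr_ge0 ltW//; exact: F_lt1.
- by apply/measurable_EFinP; exact: measurable_funTS.
move=> t /=; rewrite in_itv /= => /andP[xt ty]; rewrite lee_fin.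
apply: (le_trans _ (hazard_ge _)); last by apply: ltW; exact: le_lt_trans x0 xt.
by rewrite ler_wpM2l ?(ltW L_gt0)// lerB// dens_cdf_mono.
Qed.

(* Discrete form of the Gronwall inequality, whose limit [n -> oo] is [survival_decay]. *)
Lemma survival_steps n e x : 0 <= e -> 0 <= x ->
  (1 - F (x + n%:R * e)) * (1 + L * e) ^+ n <= 1 - F x.
Proof.
move=> e0 x0; elim: n => [|n IHn]; first by rewrite mul0r addr0 expr0 mulr1.
apply: le_trans IHn; rewrite exprS mulrA ler_wpM2r//.
  by rewrite exprn_ge0// addr_ge0// mulr_ge0// ltW.
have ne0 : 0 <= n%:R * e by rewrite mulr_ge0.
have := @dens_cdf_increment (x + n%:R * e) (x + n.+1%:R * e).
have -> : x + n.+1%:R * e - (x + n%:R * e) = e by rewrite -natr1; ring.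
rewrite addr_ge0// lerD2l ler_wpM2r// ?ler_nat// => /(_ isT isT).
by set y := F _; set z := F _; nra.
Qed.

(** Take [n] steps of length [(y - x) / n]. Since [(1 + c / n) ^+ n >= expR (c - c ^+ 2 / n)], the
    relative loss is at most [c ^+ 2 / n], which vanishes in the limit. *)
Lemma survival_decay x y : 0 <= x -> x <= y -> (1 - F y) * expR (L * (y - x)) <= 1 - F x.
Proof.
move=> x0 xy; set c := L * (y - x).
have c0 : 0 <= c by rewrite mulr_ge0 ?subr_ge0// ltW.
have Fy : 0 <= 1 - F y by rewrite subr_ge0 ltW//; exact: F_lt1.
apply: (@ler_of_small _ _ _ (c ^+ 2) 1) => //; first by rewrite mulr_ge0// expR_ge0.
move=> e /andP[e0 _].
pose n := (Num.truncn e^-1).+1.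
have n0 : 0 < n%:R :> R by rewrite ltr0n.
have en : n%:R^-1 <= e.
  rewrite -[leRHS]invrK lef_pV2 ?posrE ?invr_gt0//.
  by rewrite ltW// /n truncnS_gt.
pose v := c / n%:R.
have v0 : 0 <= v by rewrite divr_ge0// ltW.
have := @survival_steps n ((y - x) / n%:R) x.
rewrite divr_ge0 ?subr_ge0 ?(ltW n0)// => /(_ isT x0).
have -> : x + n%:R * ((y - x) / n%:R) = y by field; rewrite gt_eqF.
rewrite mulrA -/c -/v; apply: le_trans.
rewrite -mulrA ler_wpM2l//.
(* The bound [1 - w <= expR (- w)] at [w = v / (1 + v)], inverted. *)
have v1 : expR (v / (1 + v)) <= 1 + v.
  rewrite -[leRHS]invrK -[leLHS]invrK lef_pV2 ?posrE ?invr_gt0 ?expR_gt0//; last by lra.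
  rewrite -expRN; apply: le_trans (expR_ge1Dx _).
  by rewrite le_eqVlt; apply/orP; left; apply/eqP; field; rewrite gt_eqF//; lra.
apply: (@le_trans _ _ (expR (v / (1 + v)) ^+ n)); last first.
  by apply: lerXn2r => //; rewrite nnegrE ?expR_ge0//; lra.
rewrite -expRM_natl.
apply: (@le_trans _ _ (expR (c - c ^+ 2 / n%:R))).
  rewrite expRD ler_wpM2l ?expR_ge0//; apply: le_trans (expR_ge1Dx _).
  by rewrite lerD2l lerN2 ler_wpM2l// sqr_ge0.
rewrite ler_expR.
have -> : c = n%:R * v by rewrite /v; field; rewrite gt_eqF.
have -> : (n%:R * v) ^+ 2 / n%:R = n%:R * v ^+ 2 by field; rewrite gt_eqF.
rewrite -mulrBr; apply: ler_wpM2l; first exact: ltW.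
rewrite ler_pdivlMr; last by lra.
nra.
Qed.

Hypothesis f_neg : forall t, t < 0 -> f t = 0.

Lemma dens_cdf_neg x : x < 0 -> F x = 0.
Proof.
move=> x0; rewrite /F /dens_cdf integral0_eq// => t /= tx.
by rewrite f_neg//; exact: le_lt_trans x0.
Qed.

Variable tau : R.
Hypothesis tau01 : 0 < tau < 1.

Let Q := quantile F tau.

Lemma quantile_set_neq0 : [set x | tau <= F x] !=set0.
Proof.
have [t0 t1] := andP tau01.
(* Chosen so that [1 + L * y = (1 - tau)^-1]; decay from 0 then gives [1 - F y <= 1 - tau]. *)
pose y := tau / (1 - tau) / L.
have y0 : 0 <= y by rewrite !divr_ge0 ?(ltW L_gt0)//; lra.
exists y => /=.
have := survival_decay (lexx 0) y0; rewrite subr0 => h.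
have h2 : (1 - F y) * (1 + L * y) <= 1.
  have F0 : 0 <= F 0 by rewrite /F fine_ge0//; apply: integral_ge0 => t _; rewrite lee_fin.
  have : (1 - F y) * (1 + L * y) <= (1 - F y) * expR (L * y).
    by apply: ler_wpM2l; [rewrite subr_ge0 ltW//; exact: F_lt1|exact: expR_ge1Dx].
  lra.
have E : 1 + L * y = (1 - tau)^-1 by rewrite /y; field; rewrite !gt_eqF//; lra.
by move: h2; rewrite E ler_pdivrMr; lra.
Qed.

Lemma quantile_lb : lbound [set x | tau <= F x] 0.
Proof.
have [t0 t1] := andP tau01.
by move=> x /= tx; rewrite leNgt; apply/negP => /dens_cdf_neg; lra.
Qed.

Lemma quantile_ge0 : 0 <= Q.
Proof. exact: lb_le_inf quantile_set_neq0 quantile_lb. Qed.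

Lemma le_dens_cdf_gt_quantile x : Q < x -> tau <= F x.
Proof.
move=> Qx; have [|y /= ty yx] := inf_lt _ Qx.
  exact: quantile_set_neq0.
exact: le_trans ty (dens_cdf_mono (ltW yx)).
Qed.

Lemma dens_cdf_lt_quantile x : x < Q -> F x < tau.
Proof.
move=> xQ; rewrite ltNge; apply/negP => tx.
by move: xQ; rewrite ltNge => /negP; apply; apply: ge_inf => //; exists 0; exact: quantile_lb.
Qed.

(** Decay is applied from [Q + e], where [F] is at least [tau], to [Q + g]; then [e] tends to 0, so
    the value of [F] at [Q] never enters. *)
Lemma survival_above_quantile g : 0 < g -> 1 - F (Q + g) <= (1 - tau) * expR (- (L * g)).
Proof.
move=> g0; rewrite expRN -ler_pdivrMr ?invr_gt0 ?expR_gt0// invrK.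
have Fy : 0 <= 1 - F (Q + g) by rewrite subr_ge0 ltW//; exact: F_lt1.
apply: (@ler_of_small _ _ _ L g) => //; first by rewrite mulr_ge0// expR_ge0.
move=> e /andP[e0 eg].
have te : tau <= F (Q + e) by apply: le_dens_cdf_gt_quantile; rewrite ltrDl.
have := @survival_decay (Q + e) (Q + g).
rewrite addr_ge0 ?quantile_ge0 ?(ltW e0)// lerD2l (ltW eg) => /(_ isT isT) h.
apply: (@le_trans _ _ (1 - F (Q + e))); last by rewrite lerD2l lerN2.
apply: le_trans h; rewrite -mulrA ler_wpM2l//.
have -> : L * (Q + g - (Q + e)) = L * g + - (L * e) by ring.
by rewrite expRD ler_wpM2l ?expR_ge0// expR_ge1Dx.
Qed.

(** Decay runs from [Q - g] to [Q - e], where [F] is below [tau]. It is available only on the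
    support, whence [0 <= Q - g]. *)
Lemma survival_below_quantile g : 0 < g -> 0 <= Q - g ->
  (1 - tau) * expR (L * g) <= 1 - F (Q - g).
Proof.
move=> g0 Qg.
have [t0 t1] := andP tau01.
apply: (@ler_of_small _ _ _ L g) => //; first by rewrite mulr_ge0 ?expR_ge0//; lra.
move=> e /andP[e0 eg].
have te : F (Q - e) < tau by apply: dens_cdf_lt_quantile; rewrite gtrBl.
have := @survival_decay (Q - g) (Q - e).
rewrite Qg lerD2l lerN2 (ltW eg) => /(_ isT isT) h.
apply: le_trans h; rewrite -mulrA.
have -> : L * (Q - e - (Q - g)) = L * g + - (L * e) by ring.
apply: (@le_trans _ _ ((1 - tau) * expR (L * g - L * e))).
  by rewrite ler_wpM2l//; [lra|rewrite expRD ler_wpM2l ?expR_ge0// expR_ge1Dx].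
by rewrite ler_wpM2r ?expR_ge0//; lra.
Qed.

End Survival.

(** * Chernoff bound for the number of successes among independent samples *)

Section Chernoff.
Context d (T : measurableType d) (R : realType) (P : probability T R).

Lemma union_bound (I : choiceType) (s : seq I) (Pr : pred I) (A : I -> set T)
    (E : set T) (p : I -> R) :
  measurable E -> (forall i, Pr i -> measurable (A i)) ->
  (forall i, Pr i -> (P (A i) <= (p i)%:E)%E) ->
  (forall w, E w -> exists i, [/\ i \in s, Pr i & A i w]) ->
  (P E <= (\sum_(i <- s | Pr i) p i)%:E)%E.
Proof.
move=> mE mA pA EA.
have mU r : measurable (\big[setU/set0]_(i <- r | Pr i) A i) by exact: bigsetU_measurable.
apply: (@le_trans _ _ (P (\big[setU/set0]_(i <- s | Pr i) A i))).
  apply: le_measure; rewrite ?inE// => w /EA[i [si Pi Aw]].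
  by rewrite -bigcup_seq_cond; exists i => //=; rewrite si Pi.
elim: s {EA} => [|i s IHs]; first by rewrite !big_nil measure0.
rewrite !big_cons; case: ifPn => // Pi.
apply: (@le_trans _ _ (P (A i) + P (\big[setU/set0]_(j <- s | Pr j) A j))%E).
  by apply: measureU2; [exact: mA|exact: mU].
by rewrite EFinD; apply: leeD => //; exact: pA.
Qed.

Variables (I : choiceType) (X : I * nat -> T -> R) (i : I) (b : pred R) (p : R).
Hypotheses (mX : forall j, measurable_fun setT (X j)) (mb : measurable [set x | b x]).
Hypothesis X_indep : mutually_independent P X.
Hypothesis X_prob : forall k, P [set w | b (X (i, k) w)] = p%:E.

Let mXB j (B : set R) : measurable B -> measurable (X j @^-1` B).
Proof. by move=> mB; rewrite -[X in measurable X]setTI; exact: mX. Qed.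

Lemma independent_pattern_prob n (s : {ffun 'I_n -> bool}) :
  P [set w | forall k : 'I_n, b (X (i, val k) w) = s k] =
  (\prod_(k < n) (if s k then p else 1 - p))%:E.
Proof.
(* Independence asks for a set at every index; those past the first [n] samples get [setT]. *)
pose B (j : I * nat) : set R :=
  if insub j.2 is Some k then (if s k then [set x | b x] else ~` [set x | b x]) else setT.
have mB j : measurable (B j).
  rewrite /B; case: insub => [k|]; last exact: measurableT.
  by case: ifP => _ //; exact: measurableC.
have Bk (k : 'I_n) : B (i, val k) = if s k then [set x | b x] else ~` [set x | b x].
  by rewrite /B /= valK.
have := X_indep (J := [seq (i, val k) | k <- enum 'I_n]) _ mB.
rewrite map_inj_uniq ?enum_uniq//; last by move=> k l [] /val_inj.
move=> /(_ isT); rewrite !big_map -bigcap_seq => E.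
apply: (eq_trans _ (eq_trans E _)).
  congr (P _); apply/seteqP; split=> w /= Hw.
    by move=> k _; rewrite /= Bk -Hw; case: ifPn => //= /negP.
  move=> k; have := Hw k; rewrite /= Bk -enumT mem_enum => /(_ isT).
  by case: (s k) => [->//|/negP/negbTE].
rewrite -prodEFin; apply: eq_bigr => k _; rewrite Bk; case: ifP => _; first exact: X_prob.
rewrite -preimage_setC probability_setC; last exact: mXB.
by rewrite (X_prob k) -EFinB.
Qed.

(** Markov's inequality: [C * y ^+ m] dominates the indicator of [D], and its mean, a finite sum
    over success patterns, is the right-hand side. Free [C] and [y] cover both tails. *)
Lemma chernoff_bound n (D : pred nat) (C y : R) :
  0 <= y -> 0 <= p <= 1 -> (forall m, 0 <= C * y ^+ m) ->
  (forall m, D m -> 1 <= C * y ^+ m) ->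
  (P [set w | D (count b [seq X (i, k) w | k <- iota 0 n])] <=
    (C * (1 - p + p * y) ^+ n)%:E)%E.
Proof.
move=> y0 /andP[p0 p1] C0 DC.
pose cnt (s : {ffun 'I_n -> bool}) := (\sum_(k < n) s k)%N.
pose E (s : {ffun 'I_n -> bool}) := [set w | forall k : 'I_n, b (X (i, val k) w) = s k].
have mE s : measurable (E s).
  have -> : E s = \big[setI/setT]_(k <- enum 'I_n)
      (X (i, val k) @^-1` (if s k then [set x | b x] else ~` [set x | b x])).
    rewrite -bigcap_seq; apply/seteqP; split=> w /= Hw.
      by move=> k _; rewrite /= -Hw; case: ifPn => //= /negP.
    move=> k; have := Hw k; rewrite /= mem_enum => /(_ isT).
    by case: (s k) => [->//|/negP/negbTE].
  apply: bigsetI_measurable => k _; apply: mXB; case: ifP => _ //.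
  exact: measurableC.
have cntE w (s : {ffun 'I_n -> bool}) : (forall k : 'I_n, b (X (i, val k) w) = s k) ->
    count b [seq X (i, k) w | k <- iota 0 n] = cnt s.
  move=> ws; rewrite count_map -sum1_count big_mkcond /=.
  rewrite -[in LHS](subn0 n) -/(index_iota 0 n) big_mkord; apply: eq_bigr => k _.
  by rewrite /= ws; case: (s k).
pose pat w : {ffun 'I_n -> bool} := [ffun k : 'I_n => b (X (i, val k) w)].
have Epat w : E (pat w) w by move=> k; rewrite ffunE.
have mDE : [set w | D (count b [seq X (i, k) w | k <- iota 0 n])] =
    \big[setU/set0]_(s <- enum {: {ffun 'I_n -> bool}} | D (cnt s)) E s.
  rewrite -bigcup_seq_cond; apply/seteqP; split=> w /=.
    move=> Dw; exists (pat w) => //=; first by rewrite mem_enum -(cntE _ _ (Epat w)) Dw.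
  by move=> [s /= /andP[_ Ds] /cntE ->].
apply: (@le_trans _ _ (\sum_(s <- enum {: {ffun 'I_n -> bool}} | D (cnt s))
   \prod_(k < n) (if s k then p else 1 - p))%:E).
  apply: (union_bound (A := E)) => //.
  - by rewrite mDE; exact: bigsetU_measurable.
  - by move=> s _; rewrite independent_pattern_prob.
  - move=> w /= Dw; exists (pat w); split;
      [by rewrite mem_enum|by rewrite -(cntE _ _ (Epat w))|exact: Epat].
rewrite lee_fin big_enum_cond /=.
(* Distributing the product over the two outcomes of each sample gives the patterns, weighted by
   [y ^+ cnt s]. *)
have -> : C * (1 - p + p * y) ^+ n =
    \sum_(s : {ffun 'I_n -> bool}) C * y ^+ cnt s * \prod_(k < n) (if s k then p else 1 - p).
  have -> : (1 - p + p * y) ^+ n = \prod_(k < n) \sum_(c : bool) (if c then p * y else 1 - p).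
    rewrite prodr_const card_ord; congr (_ ^+ _).
    by rewrite big_bool /= addrC.
  rewrite (bigA_distr_bigA (fun k c => if c then p * y else 1 - p)) mulr_sumr.
  apply: eq_bigr => s _; rewrite -mulrA; congr (_ * _).
  rewrite /cnt -prodrXr -big_split /=; apply: eq_bigr => k _.
  by case: (s k); rewrite ?expr1 ?expr0 ?mul1r// mulrC.
rewrite big_mkcond /=; apply: ler_sum => s _.
have pr0 : 0 <= \prod_(k < n) (if s k then p else 1 - p).
  by apply: prodr_ge0 => k _; case: ifP => _ //; rewrite subr_ge0.
case: ifPn => [/DC DCs|_]; first by rewrite ler_peMl.
by rewrite mulr_ge0.
Qed.

End Chernoff.

(** * Deviations of one empirical quantile *)

Section EmpiricalQuantileDeviation.
Context d (T : measurableType d) (R : realType) (P : probability T R).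
Variables (I : choiceType) (X : I * nat -> T -> R) (i : I) (f : R -> R) (L tau : R).
Hypothesis mX : forall j, measurable_fun setT (X j).
Hypothesis X_indep : mutually_independent P X.
Hypothesis X_dens : forall k x, P [set w | X (i, k) w <= x] =
  (\int[lebesgue_measure]_(t in [set t | (t <= x)%R]) (f t)%:E)%E.
Hypothesis f_IHR : IHR_density f L.
Hypothesis tau01 : 0 < tau < 1.

Let F := dens_cdf f.
Let Q := quantile F tau.

Let mle k x : measurable [set w | X (i, k) w <= x].
Proof.
rewrite (_ : [set w | _] = X (i, k) @^-1` `]-oo, x]%classic).
  by rewrite -[X in measurable X]setTI; exact: mX.
by apply/seteqP; split=> w; rewrite /= in_itv.
Qed.

Let int_fin x : (\int[lebesgue_measure]_(t in [set t | (t <= x)%R]) (f t)%:E)%E \is a fin_num.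
Proof. by rewrite -(X_dens 0 x) fin_num_measure//; exact: mle. Qed.

Let cdf_sample k x : P [set w | X (i, k) w <= x] = (F x)%:E.
Proof. by rewrite X_dens fineK. Qed.

Let survival_sample k x : P [set w | x < X (i, k) w] = (1 - F x)%:E.
Proof.
rewrite (_ : [set w | _] = ~` [set w | X (i, k) w <= x]).
  by rewrite probability_setC// cdf_sample.
by apply/seteqP; split=> w /=; rewrite ltNge => /negP.
Qed.

Let F_bounds x : 0 <= 1 - F x <= 1.
Proof.
rewrite -!lee_fin -(survival_sample 0) measure_ge0 probability_le1//.
rewrite (_ : [set w | _] = ~` [set w | X (i, 0%N) w <= x]).
  by apply: measurableC; exact: mle.
by apply/seteqP; split=> w /=; rewrite ltNge => /negP.
Qed.

Let mgt c : measurable [set x : R | c < x].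
Proof. by rewrite -set_itvoy; exact: measurable_itv. Qed.

Let idx n := (Num.truncn (n%:R * (1 - tau))).-1.

Let emp_quantile_gt_sample n c w : (0 < n)%N ->
  (c < emp_quantile tau [seq X (i, k) w | k <- iota 0 n]) =
  (idx n < count (> c) [seq X (i, k) w | k <- iota 0 n])%N.
Proof. by move=> n0; rewrite emp_quantile_gt// size_map size_iota. Qed.

Let expR_gap (p y C : R) n : 0 <= p <= 1 -> 0 <= y -> 0 <= C ->
  C * (1 - p + p * y) ^+ n <= C * expR (n%:R * (p * (y - 1))).
Proof.
move=> /andP[p0 p1] y0 C0; rewrite ler_wpM2l// expRM_natl lerXn2r// ?nnegrE ?expR_ge0//.
  by rewrite addr_ge0 ?mulr_ge0 ?subr_ge0.
by apply: le_trans (expR_ge1Dx _); rewrite le_eqVlt; apply/orP; left; apply/eqP; ring.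
Qed.

(** The tilt [y = expR u] cancels the decay of the survival function: [p * (y - 1) <= (1 - tau) * (1
    - expR (- u))], which is the exponent in [upper_exponent_le]. *)
Lemma emp_quantile_upper n (g t : R) : (0 < n)%N -> 0 < g -> 1 <= t ->
  t * (8 + 16 / 3 * (L * g)) <= n%:R * (1 - tau) * (L * g) ^+ 2 ->
  (P [set w | (Q + g < emp_quantile tau [seq X (i, k) w | k <- iota 0 n])%R] <=
   (expR (- t))%:E)%E.
Proof.
move=> n0 g0 t1 tE; have [t0' t1'] := andP tau01.
have L0 : 0 < L by case: f_IHR => ? ? ? ? [].
set u := L * g in tE *; have u0 : 0 < u by rewrite mulr_gt0.
have n0R : 0 < n%:R :> R by rewrite ltr0n.
have [_ _ f_neg _ _] := f_IHR.
have pE := survival_above_quantile f_IHR int_fin f_neg tau01 g0.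
set p := 1 - dens_cdf f _ in pE.
under eq_set do rewrite emp_quantile_gt_sample//.
(* [C] makes [C * y ^+ m] equal to 1 at the smallest count in the event, [m = (idx n).+1]. *)
set y := expR u; set C := expR (- (u * (idx n).+1%:R)).
have CyE m : C * y ^+ m = expR (u * m%:R - u * (idx n).+1%:R).
  by rewrite /C /y -expRM_natr -expRD addrC.
have := @chernoff_bound _ _ _ P I X i (fun x : R => (Q + g < x)%R) p mX (mgt _) X_indep
  (fun k => survival_sample k _) n (fun m => (idx n < m)%N) C y (expR_ge0 _) (F_bounds _).
move=> /(_ _ _)/le_trans -> //.
- by move=> m; rewrite CyE expR_ge0.
- move=> m im; rewrite CyE -[leLHS]expR0 ler_expR -mulrBr mulr_ge0 ?(ltW u0)//.
  by rewrite subr_ge0 ler_nat.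
rewrite lee_fin.
apply: le_trans (expR_gap _ (F_bounds _) (expR_ge0 _) (expR_ge0 _)) _.
rewrite -expRD ler_expR.
have s0 : 0 < n%:R * (1 - tau) by rewrite mulr_gt0// subr_gt0.
have k1 : 1 <= (idx n).+1%:R :> R by rewrite ler1n.
(* Truncation loses at most 1, and [(idx n).+1] is at least the truncated rank, also when that rank
   is 0. *)
have sk : n%:R * (1 - tau) <= (idx n).+1%:R + 1.
  apply: (@le_trans _ _ (Num.truncn (n%:R * (1 - tau))).+1%:R).
    by rewrite ltW// truncnS_gt.
  by rewrite natr1 ler_nat ltnS /idx; case: Num.truncn.
apply: le_trans (upper_exponent_le s0 u0 t1 k1 sk tE).
rewrite lerD2l -mulrA ler_wpM2l ?(ltW n0R)//.
have y1 : 0 <= y - 1 by rewrite subr_ge0 -expR0 ler_expR ltW.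
apply: (le_trans (ler_wpM2r y1 pE)).
rewrite -mulrA le_eqVlt; apply/orP; left; apply/eqP; congr (_ * _).
by rewrite mulrBr mulr1 -expRD addNr expR0.
Qed.

(** Small counts are now the rare event, so the tilt is [expR (- u)], matched to the lower bound
    [(1 - tau) * expR u] for the success probability. *)
Lemma emp_quantile_lower n (g t : R) : (0 < n)%N -> 0 < g -> 0 <= t ->
  t * (8 + 16 / 3 * (L * g)) <= n%:R * (1 - tau) * (L * g) ^+ 2 ->
  (P [set w | (emp_quantile tau [seq X (i, k) w | k <- iota 0 n] <= Q - g)%R] <=
   (expR (- t))%:E)%E.
Proof.
move=> n0 g0 t1 tE; have [t0' t1'] := andP tau01.
have L0 : 0 < L by case: f_IHR => ? ? ? ? [].
set u := L * g in tE *; have u0 : 0 < u by rewrite mulr_gt0.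
have n0R : 0 < n%:R :> R by rewrite ltr0n.
have [_ _ f_neg _ _] := f_IHR.
under eq_set do rewrite leNgt emp_quantile_gt_sample// -leqNgt.
(* Below the support, the hazard bound says nothing but the samples are almost
   surely nonnegative. *)
have [Qg|Qg] := ltP (Q - g) 0.
  apply: (@le_trans _ _ (\sum_(k <- iota 0 n) (0 : R))%:E); last first.
    by rewrite big1// lee_fin expR_ge0.
  apply: (union_bound (A := fun k => [set w | X (i, k) w <= Q - g])) => //.
  - have mq := measurable_emp_quantile tau01 n0 (fun k => mX (i, k)).
    have := dmeas_bool (measurable_fun_ler mq (measurable_cst (Q - g))) [set true].
    congr measurable; apply/seteqP; split=> w /=;
      by rewrite leNgt emp_quantile_gt_sample// -leqNgt.
  - by move=> k _; rewrite cdf_sample /F dens_cdf_neg.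
  (* If all samples exceeded [Q - g], the count would be [n], which is above [idx n]. *)
  - move=> w /= cw; have : ~~ all (fun x : R => (Q - g < x)%R) [seq X (i, k) w | k <- iota 0 n].
      rewrite all_count size_map size_iota; apply: contraTneq cw => ->.
      by rewrite -ltnNge; exact: truncn_index_lt.
    by rewrite -has_predC => /hasP[_ /mapP[k kn ->]] /=; rewrite -leNgt => xk; exists k.
have pE := survival_below_quantile f_IHR int_fin f_neg tau01 g0 Qg.
set p := 1 - dens_cdf f _ in pE.
set y := expR (- u); set C := expR (u * (idx n)%:R).
have CyE m : C * y ^+ m = expR (u * (idx n)%:R - u * m%:R).
  by rewrite /C /y -expRM_natr -expRD mulNr.
have := @chernoff_bound _ _ _ P I X i (fun x : R => (Q - g < x)%R) p mX (mgt _) X_indep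
  (fun k => survival_sample k _) n (fun m => (m <= idx n)%N) C y (expR_ge0 _) (F_bounds _).
move=> /(_ _ _)/le_trans -> //.
- by move=> m; rewrite CyE expR_ge0.
- move=> m im; rewrite CyE -[leLHS]expR0 ler_expR -mulrBr mulr_ge0 ?(ltW u0)//.
  by rewrite subr_ge0 ler_nat.
rewrite lee_fin.
apply: le_trans (expR_gap _ (F_bounds _) (expR_ge0 _) (expR_ge0 _)) _.
rewrite -expRD ler_expR.
have s0 : 0 < n%:R * (1 - tau) by rewrite mulr_gt0// subr_gt0.
have ks : (idx n)%:R <= n%:R * (1 - tau).
  apply: (@le_trans _ _ (Num.truncn (n%:R * (1 - tau)))%:R).
    by rewrite ler_nat leq_pred.
  by rewrite truncn_le ltW.
apply: le_trans (lower_exponent_le s0 u0 ks tE t1).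
rewrite lerD2l -mulrA ler_wpM2l ?(ltW n0R)//.
have y1 : 0 <= 1 - y by rewrite subr_ge0 -expR0 ler_expR oppr_le0 ltW.
have := ler_wpM2r y1 pE; rewrite -mulrA [expR (L * g) * _]mulrBr mulr1.
rewrite -expRD subrr expR0 -/u => h.
have -> : p * (y - 1) = - (p * (1 - y)) by ring.
have -> : (1 - tau) * (1 - expR u) = - ((1 - tau) * (expR u - 1)) by ring.
by rewrite lerN2.
Qed.

End EmpiricalQuantileDeviation.

(** * Correctness of the algorithm when all deviations are small *)

Section QsarCorrectness.
Variables (R : realType) (K m N : nat) (tau : R) (tb : nat -> rel 'I_K).
Variables (Q : 'I_K -> R) (S : {set 'I_K}) (x : 'I_K -> nat -> R).
Hypotheses (m_gt0 : (0 < m)%N) (m_lt : (m < K)%N).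
Hypothesis tb_total : forall p, total (tb p).
Hypothesis S_top : is_top_set Q m S.
Hypothesis S_unique : forall S', is_top_set Q m S' -> S' = S.
Hypothesis Q_ge0 : forall i, 0 <= Q i.

Let q p i := emp_quantile tau [seq x i k | k <- iota 0 (n_phase R K N p)].

Lemma qsar_correct :
  (forall p i, (0 < p < K)%N ->
    Q i - sorted_gap Q m S (K.+1 - p) / 4 <= q p i <= Q i + sorted_gap Q m S (K.+1 - p) / 4) ->
  qsar N m tau tb x = S.
Proof.
move=> qQ.
(* After [j] phases [K - j] arms remain, so phase [j.+1] works at the gap of rank [K.+1 - j.+1]. *)
have inv j : (j < K)%N ->
    sar_inv S (K - j) (foldl (qsar_step N tau tb x) (enum 'I_K, [::], m) (iota 1 j)).
  elim: j => [|j IHj] jK.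
    rewrite /= subn0; split=> //; [exact: enum_uniq|exact: size_enum_ord| |].
      by have [Sm _] := S_top; rewrite -Sm cardE -size_filter {1}/enum_mem -enumT.
    by split=> // i _; rewrite mem_enum.
  have := IHj (ltnW jK);
  have -> : iota 1 j.+1 = rcons (iota 1 j) j.+1.
    by rewrite -cats1 -[in LHS](addn1 j) iotaD.
  rewrite foldl_rcons.
  case: foldl => [[A M] l] AMl.
  have Kj : (K - j = (K - j.+1).+1)%N by rewrite subnSK// ltnW.
  rewrite /qsar_step; set a := sort _ A.
  rewrite -/(sar_update (q j.+1) a M l).
  have aA : perm_eq a A by rewrite perm_sort.
  have jK' : (0 < j.+1 < K)%N by [].
  have rK : (K - j.+1 < K)%N by rewrite ltn_subrL /= (leq_trans _ jK).
  have aM : sar_inv S (K - j.+1).+1 (a, M, l) by rewrite -Kj; exact: perm_sar_inv AMl.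
  have [ua sa _ _ _] := aM.
  (* By pigeonhole some active arm has the gap that [sar_update_inv] asks for. *)
  have [i0 i0a gi0] := @sorted_gap_le R K m Q S (Ordinal rK) a ua sa.
  have DE : (K.+1 - j.+1 = (K - j.+1).+1)%N by rewrite subSn// ltnW.
  apply: (sar_update_inv (Q := Q) (theta := Qo Q m) (eta := Qo Q m.+1)
    (D := sorted_gap Q m S (K - j.+1).+1)) => //.
  (* [tb] need not be transitive: only the order of consecutive arms is known. *)
  - have : sorted (fun i k => (q j.+1 k < q j.+1 i) || ((q j.+1 i == q j.+1 k) && tb j.+1 i k)) a.
      by apply: sort_sorted => i k; case: ltgtP => //= _; exact: tb_total.
    by apply: sub_sorted => i k /orP[/ltW//|/andP[/eqP-> _]].
  - by rewrite subn_gt0.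
  - exact: QoS_ge0 m_lt Q_ge0.
  - exact: QoS_lt_Qo m_gt0 m_lt S_top S_unique.
  - exact: (sorted_gap_gt0 m_gt0 m_lt S_top S_unique (Ordinal rK)).
  - by move=> i; exact: Qo_le_top m_gt0 m_lt S_top _.
  - by move=> i; exact: le_QoS_nontop m_lt S_top _.
  - by exists i0 => //; move: gi0; rewrite /gap /=; case: ifP.
  - by move=> i _; rewrite -DE; exact: qQ.
have K0 : (0 < K)%N by exact: leq_ltn_trans m_lt.
have := inv K.-1; rewrite ltn_predL K0 => /(_ isT); rewrite /qsar.
case: foldl => [[A M] l] [uA sA lA l0 [MS SAM]].
have A1 : size A = 1%N by rewrite sA; move: K0; clear; lia.
(* A single active arm is left, and [0 < l] makes it good. *)
case: A A1 lA SAM {uA sA} => [//|z [|//]] _ /= lA SAM.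
have zS : z \in S by move: l0; rewrite lA; case: (z \in S).
apply/setP => i; rewrite inE; apply/idP/idP => [|/SAM//].
by rewrite inE => /orP[/eqP->|/MS].
Qed.

End QsarCorrectness.

(** * Phase lengths against the complexity [H_tau] *)

Section PhaseExponents.
Variables (R : realType) (K N : nat) (tau : R).
Hypotheses (K_ge2 : (2 <= K)%N) (tau01 : 0 < tau < 1).
Hypothesis N_large : 4 / (1 - tau) * logbar R K + K%:R <= N%:R.

Lemma logbar_gt0 : 0 < logbar R K.
Proof.
rewrite /logbar ltr_pwDl ?invr_gt0//; apply: sumr_ge0 => i _.
by rewrite invr_ge0.
Qed.

Lemma budget_gt : 0 < N%:R - K%:R :> R.
Proof.
have [t0 t1] := andP tau01.
have : 0 < 4 / (1 - tau) * logbar R K.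
  by rewrite mulr_gt0 ?logbar_gt0// divr_gt0// subr_gt0.
by move: N_large; lra.
Qed.

(** The factor [K.+1 - p], the number of active arms, later cancels the rank factor in [H_tau]. *)
Lemma n_phase_ge p : (0 < p < K)%N ->
  (N%:R - K%:R) / logbar R K <= (n_phase R K N p)%:R * (K.+1 - p)%:R.
Proof.
move=> /andP[p0 pK]; rewrite /n_phase gtn_eqF//.
have r0 : 0 < (K.+1 - p)%:R :> R by rewrite ltr0n subn_gt0 ltnW.
rewrite -ler_pdivrMr//; set z := (X in Num.ceil X).
have -> : (N%:R - K%:R) / logbar R K / (K.+1 - p)%:R = z by rewrite /z mulrAC mulrC mulrA.
have z0 : 0 < z by rewrite !mulr_gt0 ?invr_gt0 ?logbar_gt0 ?budget_gt.
rewrite (le_trans (ceil_ge z))// natr_absz ler_int ger0_norm//.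
by rewrite ltW// ceil_gt0.
Qed.

Lemma n_phase_gt0 p : (0 < p < K)%N -> (0 < n_phase R K N p)%N.
Proof.
move=> pK; have := n_phase_ge pK; rewrite lt0n; apply: contraTneq => ->.
by rewrite mul0r -ltNge divr_gt0 ?logbar_gt0 ?budget_gt.
Qed.

Variables (m : nat) (L b Q : 'I_K -> R) (S : {set 'I_K}).
Hypotheses (L_gt0 : forall i, 0 < L i) (b_ge0 : forall i, 0 <= b i).
Hypothesis D_gt0 : forall j : 'I_K, 0 < sorted_gap Q m S j.+1.

Let E := (N%:R - K%:R) / (logbar R K * H_tau tau L b Q m S).

(** [H_tau] is at least its entry for arm [i] and rank [K.+1 - p]. As [alpha_c >= 4] and
    [beta_c >= 8 / 3 * L i], that entry contributes at least [16 + 8 / 3 * L i * D]; substituting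
    [D = 4 * g] and dividing by 16 yields the constants 8 and 16/3. *)
Lemma phase_exponent p i : (0 < p < K)%N ->
  let g := sorted_gap Q m S (K.+1 - p) / 4 in
  E * (8 + 16 / 3 * (L i * g)) <= (n_phase R K N p)%:R * (1 - tau) * (L i * g) ^+ 2.
Proof.
move=> pK; have [p0 pK'] := andP pK.
have rK : (K - p < K)%N by rewrite ltn_subrL p0 (leq_trans _ K_ge2).
(* Ranks are one-based in [sorted_gap], so the ordinal [K - p] stands for rank [K.+1 - p]. *)
pose j := Ordinal rK.
have rE : (K.+1 - p)%N = j.+1 by rewrite /= subSn// ltnW.
have := n_phase_ge pK; rewrite rE.
have := D_gt0 j; set D := sorted_gap _ _ _ _ => D0.
set n := (n_phase _ _ _ _)%:R => nE /=.
set M := (N%:R - K%:R) / logbar R K in nE.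
have M0 : 0 < M by rewrite divr_gt0 ?logbar_gt0 ?budget_gt.
have [t0 t1] := andP tau01.
have Li := L_gt0 i; have bi := b_ge0 i.
have al : 4 <= alpha_c tau by rewrite /alpha_c ler_pdivlMr; lra.
have be : 8 / 3 * L i <= beta_c tau (L i) (b i).
  have : 0 <= b i * (1 - tau) * L i ^+ 2 by rewrite !mulr_ge0// ?subr_ge0 ?ltW// ltW.
  by rewrite /beta_c; lra.
set r : R := j.+1%:R in nE.
have r0 : 0 < r by rewrite ltr0n.
set a := alpha_c tau in al; set be' := beta_c tau (L i) (b i) in be.
pose h := 8 * r / (1 - tau) * (4 * a / (L i ^+ 2 * D ^+ 2) + be' / (L i ^+ 2 * D)).
have hH : h <= H_tau tau L b Q m S.
  rewrite /H_tau; apply: le_trans (le_bigmax _ _ i).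
  exact: (le_bigmax _ (fun j0 : 'I_K => 8 * j0.+1%:R / (1 - tau) *
    (4 * alpha_c tau / (L i ^+ 2 * sorted_gap Q m S j0.+1 ^+ 2) +
     beta_c tau (L i) (b i) / (L i ^+ 2 * sorted_gap Q m S j0.+1))) j).
pose W := 4 * a + be' * D.
have W0 : 0 < W by
  rewrite addr_gt0// mulr_gt0//; [lra|apply: lt_le_trans be; rewrite mulr_gt0//; lra].
have hE : h = 8 * r * W / ((1 - tau) * (L i * D) ^+ 2).
  by rewrite /h /W; field; rewrite !gt_eqF// subr_gt0.
have LD0 : 0 < (1 - tau) * (L i * D) ^+ 2.
  by rewrite mulr_gt0 ?subr_gt0// exprn_gt0// mulr_gt0.
have h0 : 0 < h by rewrite hE divr_gt0// !mulr_gt0.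
have H0 : 0 < H_tau tau L b Q m S by exact: lt_le_trans hH.
have EE : E = M / H_tau tau L b Q m S by rewrite /E invfM mulrA.
have EM : E * h <= M by rewrite EE mulrAC ler_pdivrMr// ler_wpM2l// ltW.
have E0 : 0 <= E by rewrite EE ltW// divr_gt0.
have E1 : E * (8 * r * W) <= n * r * ((1 - tau) * (L i * D) ^+ 2).
  have -> : E * (8 * r * W) = E * h * ((1 - tau) * (L i * D) ^+ 2).
    by rewrite hE -[RHS]mulrA divfK// gt_eqF.
  by rewrite ler_wpM2r ?(ltW LD0)//; exact: le_trans nE.
have E2 : E * (8 * W) <= n * ((1 - tau) * (L i * D) ^+ 2).
  by rewrite -(ler_pM2r r0); move: E1; lra.
have E3 : E * (8 * (16 + 8 / 3 * L i * D)) <= E * (8 * W).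
  apply: ler_wpM2l => //; rewrite ler_pM2l// lerD//; first by lra.
  by rewrite ler_wpM2r// ltW.
move: E2 E3; set LD2 := (L i * D) ^+ 2.
have -> : (L i * (D / 4)) ^+ 2 = LD2 / 16 by rewrite /LD2; field.
by move=> E2 E3; lra.
Qed.

End PhaseExponents.

(** * Union bound over phases, arms and signs *)

Unset Implicit Arguments.

Theorem theorem4 (R : realType) (d : measure_display) (T : measurableType d)
  (P : probability T R) (K m N : nat) (tau : R)
  (X : 'I_K -> nat -> T -> R) (f : 'I_K -> R -> R) (L b : 'I_K -> R)
  (S : {set 'I_K}) (tb : nat -> rel 'I_K) :
  (2 <= K)%N -> (1 <= m < K)%N -> 0 < tau < 1 ->
  4 / (1 - tau) * logbar R K + K%:R <= N%:R ->
  (* samples X i k : k-th sample of arm i; all mutually independent *)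
  (forall i k, measurable_fun setT (X i k)) ->
  mutually_independent P (fun ik : 'I_K * nat => X ik.1 ik.2) ->
  (* samples of arm i have density f i (hence are i.i.d. within an arm) *)
  (forall i k x, P [set w | X i k w <= x] =
     (\int[lebesgue_measure]_(t in [set t | (t <= x)%R]) (f i t)%:E)%E) ->
  (forall i, IHR_density (f i) (L i)) ->
  (forall i, C1_density (f i)) ->
  (forall i, 0 <= b i) ->
  (forall i n, (0 < n)%N ->
     (`| 'E_P[fun w => emp_quantile tau [seq X i k w | k <- iota 0 n]]
         - (quantile (dens_cdf (f i)) tau)%:E | <= (b i / n%:R)%:E)%E) ->
  (* S is the unique set of m arms with the largest tau-quantiles *)
  is_top_set (fun i => quantile (dens_cdf (f i)) tau) m S ->
  (forall S', is_top_set (fun i => quantile (dens_cdf (f i)) tau) m S' -> S' = S) ->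
  (* arbitrary (total) tie-breaking rule used at each phase *)
  (forall p, total (tb p)) ->
  (P [set w | qsar N m tau tb (fun i k => X i k w) != S] <=
   (2 * (K%:R) ^+ 2 *
    expR (- ((N%:R - K%:R) /
             (logbar R K * H_tau tau L b (fun i => quantile (dens_cdf (f i)) tau) m S))))%:E)%E.
Proof.
move=> K2 /andP[m0 mK] t01 NK mX indep dens ihr _ b0 _ Stop Suniq tbt.
set Q := fun i => quantile (dens_cdf (f i)) tau.
have [t0 t1] := andP t01.
have L0 i : 0 < L i by case: (ihr i) => ? ? ? ? [].
have mX' (j : 'I_K * nat) : measurable_fun setT (X j.1 j.2) by exact: mX.
have int_fin i x : (\int[lebesgue_measure]_(t in [set t | (t <= x)%R]) (f i t)%:E)%E
    \is a fin_num.
  rewrite -(dens i 0%N x) fin_num_measure//.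
  have := dmeas_bool (measurable_fun_ler (mX i 0%N) (measurable_cst x)) [set true].
  by congr measurable; apply/seteqP; split.
have Q0 i : 0 <= Q i.
  by have [_ _ f_neg _ _] := ihr i; exact: (quantile_ge0 (ihr i) (int_fin i) f_neg t01).
have D0 (j : 'I_K) : 0 < sorted_gap Q m S j.+1 := sorted_gap_gt0 m0 mK Stop Suniq j.
set E := (N%:R - K%:R) / _.
have mE : measurable [set w | qsar N m tau tb (fun i k => X i k w) != S].
  by apply: measurable_qsar => // p; exact: (n_phase_gt0 t01 NK).
have [big|small] := leP 1 (2 * K%:R ^+ 2 * expR (- E)).
  by apply: (le_trans (probability_le1 P mE)); rewrite lee_fin.
(* With [E < 1] the bound would be at least [2 * 4 * (1 / 4)], contradicting [small]. *)
have E1 : 1 <= E.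
  rewrite leNgt; apply/negP => E1; move: small; rewrite ltNge => /negP; apply.
  have K4 : 4 <= K%:R ^+ 2 :> R.
    by rewrite -natrX (ler_nat R 4); move: K2; clear; case: K => [|[|k]] //; nia.
  have e4 : 1 / 4 <= expR (- E).
    apply: (@le_trans _ _ (expR (- 1))); last by rewrite ler_expR lerN2 ltW.
    by apply: le_trans (expRN_ge_quadratic _); lra.
  nra.
pose q p i w := emp_quantile tau [seq X i k w | k <- iota 0 (n_phase R K N p)].
pose g p := sorted_gap Q m S (K.+1 - p) / 4.
(* The bad events, indexed by phase, arm and sign; [phase] excludes the value 0, so that phases run
   from 1 to [K.-1]. *)
pose A (c : 'I_K * 'I_K * bool) : set T :=
  if c.2 then [set w | Q c.1.2 + g c.1.1 < q c.1.1 c.1.2 w]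
  else [set w | q c.1.1 c.1.2 w <= Q c.1.2 - g c.1.1].
pose phase (c : 'I_K * 'I_K * bool) := (0 < c.1.1)%N.
have n0 (p : 'I_K) : (0 < p)%N -> (0 < n_phase R K N p)%N.
  by move=> p0; apply: (n_phase_gt0 t01 NK); rewrite p0 ltn_ord.
have g0 (p : 'I_K) : (0 < p)%N -> 0 < g p.
  move=> p0; rewrite /g subSn ?(ltnW (ltn_ord p))// divr_gt0//.
  have rK : (K - p < K)%N by rewrite ltn_subrL p0 (leq_trans _ K2).
  exact: (D0 (Ordinal rK)).
have mq p i : (0 < n_phase R K N p)%N -> measurable_fun setT (q p i).
  by move=> np; exact: measurable_emp_quantile.
apply: (@le_trans _ _ (\sum_(c <- enum {: 'I_K * 'I_K * bool} | phase c) expR (- E))%:E).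
  apply: (union_bound (A := A)) => //.
  - case=> [[p i] c]; rewrite /phase /A /= => p0; have np := n0 _ p0; case: c.
      have := dmeas_bool (measurable_fun_ltr (measurable_cst (Q i + g p)) (mq _ i np)) [set true].
      by congr measurable; apply/seteqP; split.
    have := dmeas_bool (measurable_fun_ler (mq _ i np) (measurable_cst (Q i - g p))) [set true].
    by congr measurable; apply/seteqP; split.
  - case=> [[p i] c]; rewrite /phase /A /= => p0; have np := n0 _ p0.
    have pK : (0 < p < K)%N by rewrite [(0 < p)%N]p0 ltn_ord.
    have pE := phase_exponent K2 t01 NK L0 b0 D0 i pK.
    have gp := g0 _ p0.
    case: c.
      exact: (emp_quantile_upper mX' indep (dens i) (ihr i) t01 np gp E1 pE).
    exact: (emp_quantile_lower mX' indep (dens i) (ihr i) t01 np gp (le_trans ler01 E1) pE).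
  (* Outside every bad event all errors are within a quarter of the gap, and [qsar_correct] gives
     the output [S]. *)
  - move=> w /= wS; apply: contrapT => noA; move/negP: wS; apply; apply/eqP.
    apply: (qsar_correct m0 mK tbt Stop Suniq Q0) => p i pK.
    have [p0 pK'] := andP pK.
    have nA c : ~ A (Ordinal pK', i, c) w.
      by move=> Ac; apply: noA; exists (Ordinal pK', i, c); rewrite mem_enum.
    have := nA true; have := nA false; rewrite /A /= -/(g p) -/(Q i) -/(q p i w).
    by move=> /negP; rewrite -ltNge => /ltW -> /negP; rewrite -leNgt.
rewrite lee_fin big_enum_cond /= sumr_const -[leLHS]mulr_natl.
rewrite ler_wpM2r ?expR_ge0//.
apply: (@le_trans _ _ #|{: 'I_K * 'I_K * bool}|%:R).
  by rewrite ler_nat max_card.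
rewrite !card_prod card_ord card_bool !natrM expr2; lra.
Qed.
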